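(* Let $\mathcal{G}$ be a strict 2-group presented by a crossed module $(G,H,\rhd,\partial)$ acting strictly on a small category $\mathbf{C}$, with associated action functor $\hat\Phi:\mathcal{G}\times\mathbf{C}\to\mathbf{C}$. Then the transformation $\mathbf{Cat}$-groupoid $\mathbf{C}/\!\!/\mathcal{G}$, consisting of the data below, is a well-defined groupoid internal to $\mathbf{Cat}$ (the category of small categories and functors): - category of objects $\mathbf{C}$; category of morphisms $\mathcal{G}\times\mathbf{C}$; - source functor $s=\pi_{\mathbf{C}}:\mathcal{G}\times\mathbf{C}\to\mathbf{C}$, the projection; - target functor $t=\hat\Phi:\mathcal{G}\times\mathbf{C}\to\mathbf{C}$; - identity inclusion functor $e:\mathbf{C}\to\mathcal{G}\times\mathbf{C}$, $x\mapsto(1_G,x)$, $f\mapsto((1_G,1_H),f)$; - inverse functor $\mathrm{inv}:\mathcal{G}\times\mathbf{C}\to\mathcal{G}\times\mathbf{C}$, $(\gamma,x)\mapsto(\gamma^{-1},\gamma\blacktriangleright x)$, $((\gamma,\chi),f)\mapsto((\gamma^{-1},\gamma^{-1}\rhd\chi^{-1}),(\gamma,\chi)\blacktriangleright f)$; - category of composable pairs $\mathbf{P}$, the pullback of $\pi_{\mathbf{C}}$ and $\hat\Phi$ (pairs whose first entry has source equal to the target of the second entry); - composition functor $\circ:\mathbf{P}\to\mathcal{G}\times\mathbf{C}$ given on objects by $(\gamma',\gamma\blacktriangleright x)\circ(\gamma,x)=(\gamma'\gamma,x)$ and on morphisms by $((\gamma_1,\chi_1),(\gamma_3,\chi_2)\blacktriangleright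 f)\circ((\gamma_3,\chi_2),f)=((\gamma_1\gamma_3,\chi_1(\gamma_1\rhd\chi_2)),f)$.
   Context: A crossed module $(G,H,\rhd,\partial)$ consists of groups $G,H$, an action $\rhd$ of $G$ on $H$ by automorphisms, and a homomorphism $\partial:H\to G$ with $\partial(g\rhd\eta)=g\,\partial(\eta)g^{-1}$ and $\partial(\eta)\rhd\zeta=\eta\zeta\eta^{-1}$. The 2-group $\mathcal{G}$ presented by it is the strict 2-category with one object, 1-morphisms the elements of $G$ (composition = multiplication in $G$), and 2-morphisms $(\gamma,\chi)\in G\times H$, $(\gamma,\chi):\gamma\Rightarrow\partial(\chi)\gamma$. Vertical composition: $(\partial(\chi)\gamma,\chi')\cdot(\gamma,\chi)=(\gamma,\chi'\chi)$; identity on $\gamma$ is $(\gamma,1_H)$; horizontal composition: $(\gamma_1,\chi_1)\circ(\gamma_3,\chi_2)=(\gamma_1\gamma_3,\chi_1(\gamma_1\rhd\chi_2))$. Equivalently, $\mathcal{G}$ is regarded as a category (categorical group) with objects $G$, morphisms $(\gamma,\chi):\gamma\to\partial(\chi)\gamma$, composition the vertical composition, and monoidal product $\otimes$ given by multiplication in $G$ on objects and horizontal composition on morphisms. A strict action of $\mathcal{G}$ on $\mathbf{C}$ is a strict 2-functor $\Phi:\mathcal{G}\to\mathbf{Cat}$ sending the unique object to $\mathbf{C}$: endofunctors $\Phi_\gamma:\mathbf{C}\to\mathbf{C}$ and natural transformations $\Phi_{(\gamma,\chi)}:\Phi_\gamma\Rightarrow\Phi_{\partial(\chi)\gamma}$,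 strictly preserving all compositions and identities. The associated action functor $\hat\Phi:\mathcal{G}\times\mathbf{C}\to\mathbf{C}$ is $\hat\Phi(\gamma,x)=\Phi_\gamma(x)$ on objects and $\hat\Phi((\gamma,\chi),f)=\Phi_{(\gamma,\chi)}(y)\circ\Phi_\gamma(f)$ for $f:x\to y$. Notation: $\gamma\blacktriangleright x=\hat\Phi(\gamma,x)$, $(\gamma,\chi)\blacktriangleright f=\hat\Phi((\gamma,\chi),f)$. *)

(* Defs.v *)
From HB Require Import structures.
From mathcomp Require Import all_boot.
From mathcomp Require Import boolp.

Set Implicit Arguments.
Unset Strict Implicit.
Unset Printing Implicit Defensive.

Local Open Scope group_scope.

Declare Scope cat_scope.
Delimit Scope cat_scope with cat.

(* A small category, presented by a type of objects and a single type of
   arrows (rather than a family of hom-types), so that equality of arrows, and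
   hence strict equality of functors, is plain Leibniz equality. The arrow
   [ccomp g f h] is "g after f"; it depends on a proof [h] of composability
   only through its existence, by proof irrelevance. *)
Record category : Type := Category {
  ob : Type;
  arr : Type;
  dom : arr -> ob;
  cod : arr -> ob;
  cidm : ob -> arr;
  ccomp : forall g f : arr, dom g = cod f -> arr;
  dom_cidm : forall x, dom (cidm x) = x;
  cod_cidm : forall x, cod (cidm x) = x;
  dom_ccomp : forall g f (h : dom g = cod f), dom (ccomp h) = dom f;
  cod_ccomp : forall g f (h : dom g = cod f), cod (ccomp h) = cod g;
  ccomp1l : forall f (h : dom (cidm (cod f)) = cod f), ccomp h = f;
  ccomp1r : forall f (h : dom f = cod (cidm (dom f))), ccomp h = f;
  ccompA : forall k g f (hkg : dom k = cod g) (hgf : dom g = cod f)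
    (hl : dom (ccomp hkg) = cod f) (hr : dom k = cod (ccomp hgf)),
    ccomp hl = ccomp hr
}.

Arguments dom {c} _.
Arguments cod {c} _.
Arguments cidm {c} _.
Arguments ccomp {c} g f _.

Record functor (C D : category) : Type := Functor {
  fob :> ob C -> ob D;
  farr : arr C -> arr D;
  fdom : forall f, dom (farr f) = fob (dom f);
  fcod : forall f, cod (farr f) = fob (cod f);
  fcidm : forall x, farr (cidm x) = cidm (fob x);
  fccomp : forall g f (h : dom g = cod f)
    (h' : dom (farr g) = cod (farr f)),
    farr (ccomp g f h) = ccomp (farr g) (farr f) h'
}.

Lemma functor_eq (C D : category) (F K : functor C D) :
  fob F =1 fob K -> farr F =1 farr K -> F = K.
Proof.
case: F K => [fo fa a b c d] [ko ka a' b' c' d'] /= /funext E1 /funext E2.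
subst ko ka; congr Functor; exact: Prop_irrelevance.
Qed.

Lemma ccomp_congr (C : category) (g g' f f' : arr C)
    (h : dom g = cod f) (h' : dom g' = cod f') :
  g = g' -> f = f' -> ccomp g f h = ccomp g' f' h'.
Proof. by move=> eg ef; subst g' f'; congr ccomp; exact: Prop_irrelevance. Qed.

Definition fidm (C : category) : functor C C.
Proof.
refine (@Functor C C id id _ _ _ _) => //.
by move=> g f h h'; apply: ccomp_congr.
Defined.

Definition fcomp (C D E : category) (K : functor D E) (F : functor C D) :
  functor C E.
Proof.
refine (@Functor C E (fob K \o fob F) (farr K \o farr F) _ _ _ _) => /=.
- by move=> f; rewrite !fdom.
- by move=> f; rewrite !fcod.
- by move=> x; rewrite !fcidm.
- move=> g f h h'.
  have hF : dom (farr F g) = cod (farr F f) by rewrite fdom fcod h.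
  by rewrite (fccomp h hF) (fccomp hF h').
Defined.

Notation "K \oF F" := (fcomp K F)
  (at level 50, left associativity) : cat_scope.
Local Open Scope cat_scope.

Record nat_trans (C D : category) (F K : functor C D) : Type := NatTrans {
  ntc :> ob C -> arr D;
  ntc_dom : forall x, dom (ntc x) = F x;
  ntc_cod : forall x, cod (ntc x) = K x;
  ntc_nat : forall (f : arr C)
    (h : dom (farr K f) = cod (ntc (dom f)))
    (h' : dom (ntc (cod f)) = cod (farr F f)),
    ccomp (farr K f) (ntc (dom f)) h = ccomp (ntc (cod f)) (farr F f) h'
}.

Lemma ntc_natE (C D : category) (F K : functor C D) (a : nat_trans F K)
    (f : arr C) (x y : ob C) (h : dom (farr K f) = cod (a x))
    (h' : dom (a y) = cod (farr F f)) :
  dom f = x -> cod f = y ->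
  ccomp (farr K f) (a x) h = ccomp (a y) (farr F f) h'.
Proof. by move=> ex ey; subst x y; exact: ntc_nat. Qed.

Definition nt_id (C D : category) (F : functor C D) : nat_trans F F.
Proof.
refine (@NatTrans C D F F (fun x => cidm (F x)) _ _ _) => [x|x|f].
- exact: dom_cidm.
- exact: cod_cidm.
- rewrite -fdom -fcod => h h'; by rewrite ccomp1l ccomp1r.
Defined.

Lemma nt_vcomp_subproof (C D : category) (F K L : functor C D)
  (b : nat_trans K L) (a : nat_trans F K) (x : ob C) : dom (b x) = cod (a x).
Proof. by rewrite ntc_dom ntc_cod. Qed.

Definition nt_vcomp (C D : category) (F K L : functor C D)
  (b : nat_trans K L) (a : nat_trans F K) : nat_trans F L.
Proof.
refine (@NatTrans C D F L
  (fun x => ccomp (b x) (a x) (nt_vcomp_subproof b a x)) _ _ _).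
- by move=> x; rewrite dom_ccomp ntc_dom.
- by move=> x; rewrite cod_ccomp ntc_cod.
- move=> f h h'.
  have h1 : dom (farr L f) = cod (b (dom f)) by rewrite fdom ntc_cod.
  have h2 : dom (b (cod f)) = cod (farr K f) by rewrite fcod ntc_dom.
  have h3 : dom (farr K f) = cod (a (dom f)) by rewrite fdom ntc_cod.
  have h4 : dom (a (cod f)) = cod (farr F f) by rewrite fcod ntc_dom.
  have k1 : dom (ccomp _ _ h1) = cod (a (dom f)).
    by rewrite dom_ccomp ntc_dom ntc_cod.
  rewrite -(ccompA (hkg := h1) k1).
  have k2 : dom (ccomp _ _ h2) = cod (a (dom f)).
    by rewrite dom_ccomp fdom ntc_cod.
  have k3 : dom (b (cod f)) = cod (ccomp _ _ h3).
    by rewrite cod_ccomp fcod ntc_dom.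
  have k4 : dom (b (cod f)) = cod (ccomp _ _ h4).
    by rewrite cod_ccomp ntc_cod ntc_dom.
  rewrite (ccompA h' k4).
  transitivity (ccomp _ _ k2); first exact: ccomp_congr (ntc_nat _ _) _.
  rewrite (ccompA k2 k3); exact: ccomp_congr (ntc_nat _ _).
Defined.

Lemma nt_hcomp_subproof (C D E : category) (F F' : functor C D)
  (K K' : functor D E) (b : nat_trans K K') (a : nat_trans F F') (x : ob C) :
  dom (b (F' x)) = cod (farr K (a x)).
Proof. by rewrite ntc_dom fcod ntc_cod. Qed.

Definition nt_hcomp (C D E : category) (F F' : functor C D)
  (K K' : functor D E) (b : nat_trans K K') (a : nat_trans F F') :
  nat_trans (K \oF F) (K' \oF F').
Proof.
refine (@NatTrans C E (K \oF F) (K' \oF F')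
  (fun x => ccomp (b (F' x)) (farr K (a x)) (nt_hcomp_subproof b a x)) _ _ _).
- by move=> x; rewrite dom_ccomp fdom ntc_dom.
- by move=> x; rewrite cod_ccomp ntc_cod.
- move=> f /= h h'.
  have h1 : dom (farr K' (farr F' f)) = cod (b (F' (dom f))).
    by rewrite !fdom ntc_cod.
  have h2 : dom (b (F' (cod f))) = cod (farr K (farr F' f)).
    by rewrite !fcod ntc_dom.
  have e1 := ntc_natE h1 h2 (fdom F' f) (fcod F' f).
  have g1 : dom (farr F' f) = cod (a (dom f)) by rewrite fdom ntc_cod.
  have g2 : dom (a (cod f)) = cod (farr F f) by rewrite fcod ntc_dom.
  have e2 := congr1 (farr K) (ntc_nat g1 g2).
  have q1 : dom (farr K (farr F' f)) = cod (farr K (a (dom f))).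
    by rewrite !fdom fcod ntc_cod.
  have q2 : dom (farr K (a (cod f))) = cod (farr K (farr F f)).
    by rewrite fdom !fcod ntc_dom.
  rewrite (fccomp g1 q1) (fccomp g2 q2) in e2.
  have k1 : dom (ccomp _ _ h1) = cod (farr K (a (dom f))).
    by rewrite dom_ccomp ntc_dom fcod ntc_cod.
  have k2 : dom (ccomp _ _ h2) = cod (farr K (a (dom f))).
    by rewrite dom_ccomp q1.
  have k3 : dom (b (F' (cod f))) = cod (ccomp _ _ q1).
    by rewrite cod_ccomp h2.
  have k4 : dom (b (F' (cod f))) = cod (ccomp _ _ q2).
    by rewrite cod_ccomp ntc_dom fcod ntc_cod.
  rewrite -(ccompA (hkg := h1) k1) (ccompA h' k4).
  transitivity (ccomp _ _ k2); first exact: ccomp_congr.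
  rewrite (ccompA k2 k3); exact: ccomp_congr.
Defined.

Section Products.
Variables A B : category.

Definition prod_cat : category.
Proof.
refine (@Category (ob A * ob B) (arr A * arr B)
  (fun f => (dom f.1, dom f.2)) (fun f => (cod f.1, cod f.2))
  (fun x => (cidm x.1, cidm x.2))
  (fun g f h => (ccomp g.1 f.1 (congr1 fst h), ccomp g.2 f.2 (congr1 snd h)))
  _ _ _ _ _ _ _) => /=.
- by case=> a b; rewrite !dom_cidm.
- by case=> a b; rewrite !cod_cidm.
- by move=> g f h; rewrite !dom_ccomp.
- by move=> g f h; rewrite !cod_ccomp.
- by case=> a b h; rewrite !ccomp1l.
- by case=> a b h; rewrite !ccomp1r.
- by move=> k g f hkg hgf hl hr; congr pair; apply: ccompA.
Defined.

Definition proj2 : functor prod_cat B.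
Proof.
refine (@Functor prod_cat B snd snd _ _ _ _) => // g f h h'.
exact: ccomp_congr.
Defined.

End Products.

Lemma eq_sval (T : Type) (P : T -> Prop) (u v : {x | P x}) :
  sval u = sval v -> u = v.
Proof.
by case: u v => [x p] [y q] /= e; subst y; congr exist; exact: Prop_irrelevance.
Qed.

Section Pullbacks.
Variables A B Z : category.
Variables (s : functor A Z) (t : functor B Z).

Lemma pullback_dom_subproof (p : {p : arr A * arr B | farr s p.1 = farr t p.2}) :
  s (dom (sval p).1) = t (dom (sval p).2).
Proof. by case: p => p /= e; rewrite -!fdom e. Qed.

Lemma pullback_cod_subproof (p : {p : arr A * arr B | farr s p.1 = farr t p.2}) :
  s (cod (sval p).1) = t (cod (sval p).2).
Proof. by case: p => p /= e; rewrite -!fcod e. Qed.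

Lemma pullback_cidm_subproof (p : {p : ob A * ob B | s p.1 = t p.2}) :
  farr s (cidm (sval p).1) = farr t (cidm (sval p).2).
Proof. by case: p => p /= e; rewrite !fcidm e. Qed.

Lemma pullback_ccomp_subproof (g f : arr A * arr B)
  (eg : farr s g.1 = farr t g.2) (ef : farr s f.1 = farr t f.2)
  (h1 : dom g.1 = cod f.1) (h2 : dom g.2 = cod f.2) :
  farr s (ccomp g.1 f.1 h1) = farr t (ccomp g.2 f.2 h2).
Proof.
have k1 : dom (farr s g.1) = cod (farr s f.1) by rewrite fdom fcod h1.
have k2 : dom (farr t g.2) = cod (farr t f.2) by rewrite fdom fcod h2.
by rewrite (fccomp h1 k1) (fccomp h2 k2); apply: ccomp_congr.
Qed.

Definition pullback : category.
Proof.
refine (@Category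
  {p : ob A * ob B | s p.1 = t p.2}
  {p : arr A * arr B | farr s p.1 = farr t p.2}
  (fun p => exist _ (dom (sval p).1, dom (sval p).2) (pullback_dom_subproof p))
  (fun p => exist _ (cod (sval p).1, cod (sval p).2) (pullback_cod_subproof p))
  (fun x => exist _ (cidm (sval x).1, cidm (sval x).2) (pullback_cidm_subproof x))
  (fun g f h =>
     let h1 := congr1 (fun p => (sval p).1) h in
     let h2 := congr1 (fun p => (sval p).2) h in
     exist _ (ccomp (sval g).1 (sval f).1 h1, ccomp (sval g).2 (sval f).2 h2)
       (pullback_ccomp_subproof (svalP g) (svalP f) h1 h2))
  _ _ _ _ _ _ _).
- by case=> -[a b] e; apply: eq_sval; rewrite /= !dom_cidm.
- by case=> -[a b] e; apply: eq_sval; rewrite /= !cod_cidm.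
- by move=> g f h; apply: eq_sval; rewrite /= !dom_ccomp.
- by move=> g f h; apply: eq_sval; rewrite /= !cod_ccomp.
- by case=> -[a b] e h; apply: eq_sval; rewrite /= !ccomp1l.
- by case=> -[a b] e h; apply: eq_sval; rewrite /= !ccomp1r.
- move=> k g f hkg hgf hl hr; apply: eq_sval => /=.
  by congr pair; apply: ccompA.
Defined.

Definition pbl : functor pullback A.
Proof.
refine (@Functor pullback A (fun p => (sval p).1) (fun p => (sval p).1)
  _ _ _ _) => // g f h h'.
exact: ccomp_congr.
Defined.

Definition pbr : functor pullback B.
Proof.
refine (@Functor pullback B (fun p => (sval p).2) (fun p => (sval p).2)
  _ _ _ _) => // g f h h'.
exact: ccomp_congr.
Defined.

Lemma pb_comm : s \oF pbl = t \oF pbr.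
Proof. by apply: functor_eq => p /=; exact: (svalP p). Qed.

Definition pb_pair (X : category) (u : functor X A) (v : functor X B)
  (h : s \oF u = t \oF v) : functor X pullback.
Proof.
refine (@Functor X pullback
  (fun x => exist _ (u x, v x) (congr1 (fun F : functor X Z => F x) h))
  (fun f => exist _ (farr u f, farr v f)
     (congr1 (fun F : functor X Z => farr F f) h)) _ _ _ _).
- by move=> f; apply: eq_sval; rewrite /= !fdom.
- by move=> f; apply: eq_sval; rewrite /= !fcod.
- by move=> f; apply: eq_sval; rewrite /= !fcidm.
- by move=> g f k k'; apply: eq_sval => /=; congr pair; apply: fccomp.
Defined.

Lemma pb_pairP (X : category) (u : functor X A) (v : functor X B)
    (h : s \oF u = t \oF v) (w : functor X pullback) :
  pbl \oF w = u /\ pbr \oF w = v <-> w = pb_pair h.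
Proof.
split=> [[wl wr]|->]; last by split; apply: functor_eq.
apply: functor_eq => x; apply: eq_sval => /=.
- have := congr1 (fun F : functor X A => F x) wl.
  have := congr1 (fun F : functor X B => F x) wr.
  by move=> /= <- <-; case: (sval _).
- have := congr1 (fun F : functor X A => farr F x) wl.
  have := congr1 (fun F : functor X B => farr F x) wr.
  by move=> /= <- <-; case: (sval _).
Qed.

End Pullbacks.

Section InternalGroupoids.
Variables C0 C1 : category.
Variables (s t : functor C1 C0) (e : functor C0 C1) (inv : functor C1 C1).
Variable m : functor (pullback s t) C1.

Let pl := pbl s t.
Let pr := pbr s t.

(* Composable triples ((a, b), (b, c)). *)
Let ql := pbl pr pl.
Let qr := pbr pr pl.

Lemma assoc_l_subproof :
  s \oF m = s \oF pr -> s \oF (m \oF ql) = t \oF (pr \oF qr).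
Proof.
move=> sm; have -> : s \oF (m \oF ql) = (s \oF m) \oF ql by apply: functor_eq.
rewrite sm; apply: functor_eq => /= x.
  by have /= -> := svalP x; exact: (svalP (sval x).2).
by have /= -> := svalP x; exact: (svalP (sval x).2).
Qed.

Lemma assoc_r_subproof :
  t \oF m = t \oF pl -> s \oF (pl \oF ql) = t \oF (m \oF qr).
Proof.
move=> tm; have -> : t \oF (m \oF qr) = (t \oF m) \oF qr by apply: functor_eq.
rewrite tm; apply: functor_eq => /= x.
  by have /= <- := svalP x; exact: (svalP (sval x).1).
by have /= <- := svalP x; exact: (svalP (sval x).1).
Qed.

Lemma unit_l_subproof :
  s \oF e = fidm C0 -> s \oF (e \oF t) = t \oF fidm C1.
Proof.
move=> se; have -> : s \oF (e \oF t) = (s \oF e) \oF t by apply: functor_eq.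
by rewrite se; apply: functor_eq.
Qed.

Lemma unit_r_subproof :
  t \oF e = fidm C0 -> s \oF fidm C1 = t \oF (e \oF s).
Proof.
move=> te; have -> : t \oF (e \oF s) = (t \oF e) \oF s by apply: functor_eq.
by rewrite te; apply: functor_eq.
Qed.

Lemma inv_l_subproof : s \oF inv = t -> s \oF inv = t \oF fidm C1.
Proof. by move=> ->; apply: functor_eq. Qed.

Lemma inv_r_subproof : t \oF inv = s -> s \oF fidm C1 = t \oF inv.
Proof. by move=> ->; apply: functor_eq. Qed.

(* The axioms of a groupoid internal to Cat, as equalities of functors. An
   element (b, a) of [pullback s t] satisfies s b = t a, and m (b, a) is
   "b after a". *)
Record is_internal_groupoid : Prop := IsInternalGroupoid {
  ig_se : s \oF e = fidm C0;
  ig_te : t \oF e = fidm C0;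
  ig_sm : s \oF m = s \oF pr;
  ig_tm : t \oF m = t \oF pl;
  ig_assoc : m \oF pb_pair (assoc_l_subproof ig_sm)
           = m \oF pb_pair (assoc_r_subproof ig_tm);
  ig_unitl : m \oF pb_pair (unit_l_subproof ig_se) = fidm C1;
  ig_unitr : m \oF pb_pair (unit_r_subproof ig_te) = fidm C1;
  ig_sinv : s \oF inv = t;
  ig_tinv : t \oF inv = s;
  ig_invl : m \oF pb_pair (inv_l_subproof ig_sinv) = e \oF s;
  ig_invr : m \oF pb_pair (inv_r_subproof ig_tinv) = e \oF t
}.

End InternalGroupoids.

Arguments is_internal_groupoid {C0 C1} s t e inv m.

Record crossed_module (G H : groupType) : Type := CrossedModule {
  cm_act : G -> H -> H;
  cm_bd : {multiplicative H -> G};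
  cm_act1 : forall eta, cm_act 1 eta = eta;
  cm_actM : forall g g' eta, cm_act (g * g') eta = cm_act g (cm_act g' eta);
  cm_actD : forall g, {morph cm_act g : eta zeta / eta * zeta};
  cm_equiv : forall g eta, cm_bd (cm_act g eta) = g * cm_bd eta * g^-1;
  cm_peiffer : forall eta zeta, cm_act (cm_bd eta) zeta = eta * zeta * eta^-1
}.

Lemma cm_bd1 (G H : groupType) (X : crossed_module G H) : cm_bd X 1 = 1.
Proof. by apply: (mulgI (cm_bd X 1)); rewrite -gmulfM !mulg1. Qed.

Section TwoGroup.
Variables (G H : groupType) (X : crossed_module G H).

Definition two_group : category.
Proof.
refine (@Category G (G * H)%type
  (fun a => a.1) (fun a => cm_bd X a.2 * a.1)
  (fun g => (g, 1))
  (fun a' a _ => (a.1, a'.2 * a.2)) _ _ _ _ _ _ _) => //=.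
- by move=> g; rewrite cm_bd1 mul1g.
- by case=> g' c' [g c] /= ->; rewrite gmulfM mulgA.
- by case=> g c _; rewrite mul1g.
- by case=> g c _; rewrite mulg1.
- by move=> *; rewrite mulgA.
Defined.

(* Horizontal composition, i.e. the tensor product on morphisms. *)
Definition two_group_hcomp (a b : arr two_group) : arr two_group :=
  (a.1 * b.1, a.2 * cm_act X a.1 b.2).

(* A strict 2-functor from the one-object 2-category to Cat with value C.
   Equalities of 2-cells are equalities of components; the equalities of their
   domains and codomains follow from those of 1-cells. *)
Record strict_action (C : category) : Type := StrictAction {
  sa1 : G -> functor C C;
  sa2 : forall a : arr two_group, nat_trans (sa1 (dom a)) (sa1 (cod a));
  sa1_id : sa1 1 = fidm C;
  sa1_comp : forall g g', sa1 (g * g') = sa1 g \oF sa1 g';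
  sa2_id : forall g x, sa2 (g, 1) x = nt_id (sa1 g) x;
  sa2_vcomp : forall g c c' x,
    sa2 (g, c' * c) x = nt_vcomp (sa2 (cm_bd X c * g, c')) (sa2 (g, c)) x;
  sa2_hcomp : forall a b x,
    sa2 (two_group_hcomp a b) x = nt_hcomp (sa2 a) (sa2 b) x
}.

Variables (C : category) (Phi : strict_action C).

Lemma action_functor_subproof (a : arr two_group) (f : arr C) :
  dom (sa2 Phi a (cod f)) = cod (farr (sa1 Phi (dom a)) f).
Proof. by rewrite ntc_dom fcod. Qed.

Definition action_functor : functor (prod_cat two_group C) C.
Proof.
refine (@Functor (prod_cat two_group C) C
  (fun p => sa1 Phi p.1 p.2)
  (fun p => ccomp (sa2 Phi p.1 (cod p.2)) (farr (sa1 Phi (dom p.1)) p.2)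
              (action_functor_subproof p.1 p.2)) _ _ _ _).
- by case=> a f; rewrite dom_ccomp fdom.
- by case=> a f; rewrite cod_ccomp ntc_cod.
- case=> g x /=.
  have h : dom (cidm (cod (cidm (sa1 Phi g x)))) = cod (cidm (sa1 Phi g x)).
    by rewrite dom_cidm.
  rewrite -[RHS](ccomp1l h); apply: ccomp_congr; last exact: fcidm.
  by rewrite sa2_id /= !cod_cidm.
- case=> [[g' c'] f'] [[g c] f] /= h h'.
  case: (h) => eg ef; subst g'.
  set bg := (_ * g) in h h' *.
  have p1 : dom f' = cod f by case: h.
  have p2 : dom (farr (sa1 Phi g) f') = cod (farr (sa1 Phi g) f).
    by rewrite fdom fcod p1.
  have q1 : dom (sa2 Phi (bg, c') (cod f')) = cod (sa2 Phi (g, c) (cod f')).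
    by rewrite ntc_dom ntc_cod.
  have q2 : dom (sa2 Phi (g, c) (cod f')) = cod (farr (sa1 Phi g) f').
    by rewrite ntc_dom fcod.
  have q3 : dom (farr (sa1 Phi bg) f') = cod (sa2 Phi (g, c) (dom f')).
    by rewrite ntc_cod fdom.
  have q4 : dom (sa2 Phi (g, c) (dom f')) = cod (farr (sa1 Phi g) f).
    by rewrite ntc_dom fcod p1.
  have nat := ntc_nat q3 q2.
  have r0 : dom (ccomp _ _ q1) = cod (ccomp _ _ p2).
    by rewrite dom_ccomp cod_ccomp ntc_dom fcod.
  transitivity (ccomp _ _ r0).
    apply: ccomp_congr; last exact: fccomp.
    rewrite cod_ccomp sa2_vcomp; exact: ccomp_congr.
  have r1 : dom (sa2 Phi (g, c) (cod f')) = cod (ccomp _ _ p2).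
    by rewrite cod_ccomp.
  have r2 : dom (sa2 Phi (bg, c') (cod f')) = cod (ccomp _ _ r1).
    by rewrite cod_ccomp.
  rewrite (ccompA r0 r2).
  have r3 : dom (ccomp _ _ q2) = cod (farr (sa1 Phi g) f) by rewrite dom_ccomp.
  have r4 : dom (ccomp _ _ q3) = cod (farr (sa1 Phi g) f) by rewrite dom_ccomp.
  have r5 : dom (farr (sa1 Phi bg) f') = cod (ccomp _ _ q4).
    by rewrite cod_ccomp.
  have E : ccomp _ _ r1 = ccomp _ _ r5.
    by rewrite -(ccompA r3 r1) -(ccompA r4 r5); apply: ccomp_congr.
  have r6 : dom (sa2 Phi (bg, c') (cod f')) = cod (farr (sa1 Phi bg) f').
    by rewrite ntc_dom fcod.
  have r7 : dom (ccomp _ _ r6) = cod (ccomp _ _ q4).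
    by rewrite dom_ccomp.
  have r8 : dom (sa2 Phi (bg, c') (cod f')) = cod (ccomp _ _ r5).
    by rewrite cod_ccomp.
  transitivity (ccomp _ _ r8); first exact: ccomp_congr.
  rewrite -(ccompA r7 r8); apply: ccomp_congr; first exact: ccomp_congr.
  by apply: ccomp_congr; rewrite ?p1.
Defined.

End TwoGroup.

(* Main.v *)
(* The action functor is a monoid action: [Phi^ (a (x) b, f) = Phi^ (a, Phi^ (b, f))]
   and [Phi^ (1, f) = f]. Since the 2-group is a strict group object in Cat, the
   groupoid axioms reduce to the group axioms for the tensor product together
   with these two identities. Functoriality of the inverse and of the
   composition is where the crossed module axioms enter: the Peiffer identity
   gives the interchange law, and equivariance gives the correct codomains. *)
Require Import Defs.
From HB Require Import structures.
From mathcomp Require Import all_boot.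

Local Open Scope group_scope.
Local Open Scope cat_scope.

(** * Group laws and functoriality for the tensor product of the 2-group *)

Section CrossedModuleTheory.
Variables (G H : groupType) (X : crossed_module G H).

Lemma cm_act_1r (g : G) : cm_act X g 1 = 1.
Proof. by apply: (mulgI (cm_act X g 1)); rewrite -cm_actD !mulg1. Qed.

Lemma cm_actV (g : G) (c : H) : cm_act X g c^-1 = (cm_act X g c)^-1.
Proof. by apply: (mulgI (cm_act X g c)); rewrite -cm_actD !mulgV cm_act_1r. Qed.

Lemma cm_bdV (c : H) : cm_bd X c^-1 = (cm_bd X c)^-1.
Proof. by apply: (mulgI (cm_bd X c)); rewrite -gmulfM !mulgV cm_bd1. Qed.

(** Inverse for the tensor product, not for vertical composition: solving [c * (g ▷ d) = 1] gives
    [d = g^-1 ▷ c^-1]. *)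
Definition two_group_hinv (a : arr (two_group X)) : arr (two_group X) :=
  (a.1^-1, cm_act X a.1^-1 a.2^-1).

Local Notation "a ⊗ b" := (two_group_hcomp a b) (at level 40).
Local Notation one := ((1, 1) : arr (two_group X)).

(** [⊗] is the multiplication of the semidirect product of [H] by [G], so the group laws follow from
    the action axioms alone. *)
Lemma two_group_hcompA (a b c : arr (two_group X)) : a ⊗ b ⊗ c = a ⊗ (b ⊗ c).
Proof. by congr pair; rewrite /= ?cm_actD -?cm_actM !mulgA. Qed.

Lemma two_group_hcomp1l (a : arr (two_group X)) : one ⊗ a = a.
Proof. by case: a => g c; rewrite /two_group_hcomp /= cm_act1 !mul1g. Qed.

Lemma two_group_hcomp1r (a : arr (two_group X)) : a ⊗ one = a.
Proof. by case: a => g c; rewrite /two_group_hcomp /= cm_act_1r !mulg1. Qed.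

Lemma two_group_hcompVl (a : arr (two_group X)) : two_group_hinv a ⊗ a = one.
Proof. by congr pair; rewrite /= ?mulVg // -cm_actD mulVg cm_act_1r. Qed.

Lemma two_group_hcompVr (a : arr (two_group X)) : a ⊗ two_group_hinv a = one.
Proof. by congr pair; rewrite /= ?mulgV // -cm_actM mulgV cm_act1 mulgV. Qed.

Lemma cod_two_group_hcomp (a b : arr (two_group X)) :
  cod (a ⊗ b) = cod a * cod b :> G.
Proof. by rewrite /= gmulfM cm_equiv !mulgA mulgVK. Qed.

Lemma cod_two_group_hinv (a : arr (two_group X)) :
  cod (two_group_hinv a) = (cod a)^-1 :> G.
Proof. by rewrite /= cm_equiv invgK mulgK cm_bdV invgM. Qed.

(** Composability makes the object [dom a'] equal to [∂c * g] for [a = (g, c)]. By Peiffer its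
    action is that of [g] followed by conjugation by [c], and the trailing [c^-1] cancels the next
    factor [c]. *)
Lemma two_group_interchange (a' a b' b : arr (two_group X))
    (ha : dom a' = cod a) (hb : dom b' = cod b)
    (h : dom (a' ⊗ b') = cod (a ⊗ b)) :
  ccomp a' a ha ⊗ ccomp b' b hb = ccomp (a' ⊗ b') (a ⊗ b) h.
Proof.
congr pair => //=; rewrite /= in ha; rewrite ha cm_actM cm_peiffer cm_actD.
by rewrite !mulgA mulgVK.
Qed.

(** Inversion in [H] reverses the factors of a vertical composite; Peiffer for [c^-1] restores their
    order. *)
Lemma two_group_hinv_ccomp (a' a : arr (two_group X)) (h : dom a' = cod a)
    (h' : dom (two_group_hinv a') = cod (two_group_hinv a)) :
  two_group_hinv (ccomp a' a h) = ccomp (two_group_hinv a') (two_group_hinv a) h'.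
Proof.
congr pair => //=; rewrite /= in h; rewrite h !invgM cm_actM -cm_actD -cm_bdV.
by rewrite cm_peiffer invgK mulgK.
Qed.

End CrossedModuleTheory.

Arguments two_group_hinv {G H X} a.

(** * The monoid action laws and the transformation groupoid *)

Section ActionGroupoid.
Variables (G H : groupType) (X : crossed_module G H) (C : category).
Variable Phi : strict_action X C.

Local Notation t := (action_functor Phi).

Lemma action_ob1 (x : ob C) : t (1, x) = x.
Proof. by rewrite /= sa1_id. Qed.

Lemma action_obM (g g' : G) (x : ob C) : t (g * g', x) = t (g, t (g', x)).
Proof. by rewrite /= sa1_comp. Qed.

Lemma action_arr1 (f : arr C) : farr t ((1, 1), f) = f.
Proof.
have h : dom (cidm (cod f)) = cod f by rewrite dom_cidm.
rewrite -[RHS](ccomp1l h) /=; apply: ccomp_congr; last by rewrite sa1_id.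
by rewrite sa2_id /= sa1_id.
Qed.

(** [sa2_hcomp] turns the left side into a triple composite; once it is reassociated, functoriality
    of [A] merges its last two arrows. *)
Lemma action_arrM (a b : arr (two_group X)) (f : arr C) :
  farr t (two_group_hcomp a b, f) = farr t (a, farr t (b, f)).
Proof.
pose A := sa1 Phi (dom a); pose b1 := sa2 Phi b (cod f).
have q1 : dom (sa2 Phi a (sa1 Phi (cod b) (cod f))) = cod (farr A b1).
  by rewrite ntc_dom fcod ntc_cod.
have q2 : dom (farr A b1) = cod (farr A (farr (sa1 Phi (dom b)) f)).
  by rewrite fdom !fcod ntc_dom.
have k1 : dom (ccomp _ _ q1) = cod (farr A (farr (sa1 Phi (dom b)) f)).
  by rewrite dom_ccomp.
have k2 : dom (sa2 Phi a (sa1 Phi (cod b) (cod f))) = cod (ccomp _ _ q2).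
  by rewrite cod_ccomp.
transitivity (ccomp _ _ k1).
  by apply: ccomp_congr; [rewrite sa2_hcomp; apply: ccomp_congr|rewrite sa1_comp].
rewrite (ccompA k1 k2); apply: ccomp_congr.
  by rewrite cod_ccomp ntc_cod.
by symmetry; apply: fccomp.
Qed.

Local Notation GC := (prod_cat (two_group X) C).
Local Notation s := (proj2 (two_group X) C).
Local Notation P := (pullback s t).

Definition unit_functor : functor C GC.
Proof.
refine (@Functor C GC (fun x => (1, x)) (fun f => ((1, 1), f)) _ _ _ _) => //=.
- by move=> f; rewrite cm_bd1 mul1g.
- move=> g f h h'; congr pair; first by rewrite mulg1.
  exact: ccomp_congr.
Defined.

Definition inverse_functor : functor GC GC.
Proof.
refine (@Functor GC GC (fun p => (p.1^-1, t p))
  (fun p => (two_group_hinv p.1, farr t p)) _ _ _ _).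
- by case=> a f; congr pair; apply: (fdom t).
- by case=> a f; congr pair; [apply: cod_two_group_hinv|apply: (fcod t)].
- case=> g x; congr pair; last exact: (fcidm t).
  by rewrite /two_group_hinv /= invg1 cm_act_1r.
- move=> p q h h'; congr pair; first exact: two_group_hinv_ccomp.
  exact: (@fccomp _ _ t).
Defined.

Definition composition_functor : functor P GC.
Proof.
refine (@Functor P GC
  (fun p => ((sval p).1.1 * (sval p).2.1, (sval p).2.2))
  (fun p => (two_group_hcomp (sval p).1.1 (sval p).2.1, (sval p).2.2))
  _ _ _ _).
- by case=> -[[a y] [b x]] e /=.
- case=> -[[a y] [b x]] e /=; congr pair; exact: cod_two_group_hcomp.
- case=> -[[a y] [b x]] e /=.
  by rewrite /two_group_hcomp /= cm_act_1r mulg1.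
- move=> p q h h'; congr pair; last exact: ccomp_congr.
  exact: two_group_interchange.
Defined.

Lemma action_groupoid :
  is_internal_groupoid s t unit_functor inverse_functor composition_functor.
Proof.
(* The source and target laws come first, since the pairings into pullbacks in the other axioms are
   built from them. *)
have se : s \oF unit_functor = fidm C by apply: functor_eq.
have te : t \oF unit_functor = fidm C.
  by apply: functor_eq; [apply: action_ob1|apply: action_arr1].
have sm : s \oF composition_functor = s \oF pbr s t.
  by apply: functor_eq; case=> -[[a y] [b x]] e /=.
have tm : t \oF composition_functor = t \oF pbl s t.
  apply: functor_eq; case=> -[[a y] [b x]] /= ->.
    exact: action_obM.
  exact: action_arrM.
have si : s \oF inverse_functor = t by apply: functor_eq.
have ti : t \oF inverse_functor = s.
  apply: functor_eq; case=> a x.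
    by rewrite -[LHS](action_obM (a : G)^-1 a x) mulVg action_ob1.
  by rewrite -[LHS](action_arrM (two_group_hinv a) a x) two_group_hcompVl
     action_arr1.
apply: (@IsInternalGroupoid _ _ s t _ _ _ se te sm tm _ _ _ si ti _ _);
  apply: functor_eq.
(* A composable triple stores its middle entry twice; [e] identifies the copies [(b, y)] and
   [(b', y')]. *)
- case=> -[[[[a z] [b y]] e1] [[[b' y'] [c x]] e2]] e /=.
  by case: e => /= <- _; rewrite mulgA.
- case=> -[[[[a z] [b y]] e1] [[[b' y'] [c x]] e2]] e /=.
  by case: e => /= <- _; rewrite two_group_hcompA.
- by case=> g x /=; rewrite mul1g.
- by case=> a f /=; rewrite two_group_hcomp1l.
- by case=> g x /=; rewrite mulg1.
- by case=> a f /=; rewrite two_group_hcomp1r.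
- by case=> g x /=; rewrite mulVg.
- by case=> a f /=; rewrite two_group_hcompVl.
- by case=> g x /=; rewrite mulgV.
- by case=> a f /=; rewrite two_group_hcompVr.
Qed.

End ActionGroupoid.

Theorem theorem4p4 (G H : groupType) (X : crossed_module G H) (C : category)
    (Phi : strict_action X C) :
  exists (e : functor C (prod_cat (two_group X) C))
    (inv : functor (prod_cat (two_group X) C) (prod_cat (two_group X) C))
    (m : functor (pullback (proj2 (two_group X) C) (action_functor Phi))
           (prod_cat (two_group X) C)),
    [/\ (forall x : ob C, fob e x = (1, x))
        /\ (forall f : arr C, farr e f = ((1, 1), f)),
        (forall (g : G) (x : ob C),
           fob inv (g, x) = (g^-1, fob (action_functor Phi) (g, x)))
        /\ (forall (g : G) (c : H) (f : arr C),
           farr inv ((g, c), f)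
           = ((g^-1, cm_act X g^-1 c^-1),
              farr (action_functor Phi) ((g, c), f))),
        (forall (g' g : G) (x : ob C)
            (p : ob (pullback (proj2 (two_group X) C) (action_functor Phi))),
           sval p = ((g', fob (action_functor Phi) (g, x)), (g, x)) ->
           fob m p = (g' * g, x))
        /\ (forall (g1 g3 : G) (c1 c2 : H) (f : arr C)
            (p : arr (pullback (proj2 (two_group X) C) (action_functor Phi))),
           sval p = (((g1, c1), farr (action_functor Phi) ((g3, c2), f)),
                     ((g3, c2), f)) ->
           farr m p = ((g1 * g3, c1 * cm_act X g1 c2), f))
      & is_internal_groupoid (proj2 (two_group X) C) (action_functor Phi)
          e inv m].
Proof.
exists (unit_functor G H X C), (inverse_functor G H X C Phi),
  (composition_functor G H X C Phi).
split; [by split|by split| |].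
  (* The functor reads only the underlying pair of [p], so [pE] determines its value. *)
  by split=> [g' g x p|g1 g3 c1 c2 f p] pE; rewrite [LHS]/= pE.
exact: action_groupoid.
Qed.
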